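(* Let $X$ and $Y$ be independent random variables, each with the unit Fréchet distribution $F(x)=e^{-1/x}$, $x>0$, and let $(X_i,Y_i)$, $i=1,\dots,n$, be a random sample (i.i.d. copies) of $(X,Y)$. Then $$\lim_{n\to\infty}\mathbb{P}\Big\{n^{-1}\Big(\max_{i\le n}Y_i/X_i+1\Big)\le x\Big\}=e^{-1/x},\qquad x>0,$$ and the random variables $\max_{i\le n}Y_i/X_i$ and $\min_{i\le n}Y_i/X_i$ are asymptotically independent, in the sense that for all $x,y>0$, $$\lim_{n\to\infty}\mathbb{P}\Big\{n^{-1}\Big(\max_{i\le n}Y_i/X_i+1\Big)\le x,\ n^{-1}\Big(\max_{i\le n}X_i/Y_i+1\Big)\le y\Big\}=e^{-1/x-1/y}.$$ Furthermore, $n q_n$ converges in distribution, as $n\to\infty$, to a gamma$(2,1)$ random variable (density $t e^{-t}$, $t>0$), where $$q_n=\frac{\max_{i\le n}\{Y_i/X_i\}+\max_{i\le n}\{X_i/Y_i\}-2}{\max_{i\le n}\{Y_i/X_i\}\times\max_{i\le n}\{X_i/Y_i\}-1}.$$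
   Context: The quantity $q_n$ is called the quotient correlation coefficient of the sample $(X_i,Y_i)_{i\le n}$ of positive random variables. *)

(* Defs.v *)
From HB Require Import structures.
From mathcomp Require Import all_boot all_order all_algebra.
From mathcomp Require Import all_classical all_reals all_analysis.
Set Implicit Arguments. Unset Strict Implicit. Unset Printing Implicit Defensive.
Import Order.TTheory GRing.Theory Num.Theory numFieldNormedType.Exports.
Local Open Scope classical_set_scope.
Local Open Scope ring_scope.

Definition mutually_independent_rv (d : measure_display) (T : measurableType d)
  (R : realType) (P : probability T R) (I : eqType) (Z : I -> T -> R) : Prop :=
  forall (J : seq I) (B : I -> set R), uniq J ->
    (forall j, j \in J -> measurable (B j)) ->
    P (\bigcap_(j in [set j | j \in J]) (Z j @^-1` B j)) =
    (\prod_(j <- J) P (Z j @^-1` B j))%E.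

Definition frechet_cdf (R : realType) (x : R) : R :=
  if 0 < x then expR (- x^-1) else 0.

(** maximum of f 0, ..., f (n-1)  (for n >= 1) *)
Definition max_upto (R : realType) (n : nat) (f : nat -> R) : R :=
  \big[Num.max/f 0%N]_(i < n) f i.

Definition qcc (R : realType) (n : nat) (X Y : nat -> R) : R :=
  let M1 := max_upto n (fun i => Y i / X i) in
  let M2 := max_upto n (fun i => X i / Y i) in
  (M1 + M2 - 2) / (M1 * M2 - 1).

Definition gamma21_cdf (R : realType) (t : R) : R :=
  Rintegral (@lebesgue_measure R) `[0, t] (fun s => s * expR (- s)).

Definition cvg_in_distribution (d : measure_display) (T : measurableType d)
  (R : realType) (P : probability T R) (Z : nat -> T -> R) (F : R -> R) : Prop :=
  forall t : R, {for t, continuous F} ->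
    (P [set w | Z n w <= t]) @[n --> \oo] --> (F t)%:E.

(* Main.v *)
(* The shares [U_i = X_i / (X_i + Y_i)] are independent and uniform on [0, 1]:
   the variables [1 / X_i] and [1 / Y_i] are independent unit exponentials, and
   such a pair satisfies [P (c A <= B) = 1 / (1 + c)].  As [1 + Y_i / X_i] is
   [1 / U_i] and [1 + X_i / Y_i] is [1 / (1 - U_i)], the maxima [M] and [M'] of
   the two ratios are given by [A_n = n / (M + 1) = n min U_i] and
   [B_n = n / (M' + 1) = n min (1 - U_i)], whence the exact joint law
   [P (a <= A_n, b <= B_n) = (1 - (a + b) / n) ^ n].  Letting [n] tend to
   infinity gives the first two limits, and shows that [A_n + B_n] has the limit
   law of a sum of two independent unit exponentials, which is gamma(2,1).
   Finally [n q_n = S + (A_n - B_n)^2 / (n - S)] with [S = A_n + B_n], and the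
   last term vanishes in probability because [S] is tight. *)
Require Import Defs.
From HB Require Import structures.
From mathcomp Require Import all_boot all_order all_algebra.
From mathcomp Require Import all_classical all_reals all_analysis.
From mathcomp Require Import measurable_realfun ring lra.
Set Implicit Arguments.
Unset Strict Implicit.
Unset Printing Implicit Defensive.
Import Order.TTheory GRing.Theory Num.Theory numFieldNormedType.Exports.
Local Open Scope classical_set_scope.
Local Open Scope ring_scope.

Lemma cvg_double_squeeze (R : realFieldType) (p : R^nat) (l u : nat -> R^nat)
    (L U : R^nat) (a : R) :
  (forall k, \forall n \near \oo, l k n <= p n <= u k n) ->
  (forall k, l k n @[n --> \oo] --> L k) -> L k @[k --> \oo] --> a ->
  (forall k, u k n @[n --> \oo] --> U k) -> U k @[k --> \oo] --> a ->
  p n @[n --> \oo] --> a.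
Proof.
move=> lpu lL La uU Ua; apply/cvgrPdist_le => e e0.
have e2 : 0 < e / 2 by rewrite divr_gt0.
have /cvgrPdist_le/(_ _ e2) nearL := La.
have /cvgrPdist_le/(_ _ e2) nearU := Ua.
have [k _ /(_ k (leqnn k))] := filterI nearL nearU.
rewrite /= !ler_distl => -[/andP[_ Lk] /andP[Uk _]].
have /cvgrPdist_le/(_ _ e2) nearl := lL k.
have /cvgrPdist_le/(_ _ e2) nearu := uU k.
near=> n; rewrite ler_distl.
have /andP[ln un] : l k n <= p n <= u k n by near: n.
have : `|L k - l k n| <= e / 2 by near: n.
have : `|U k - u k n| <= e / 2 by near: n.
rewrite !ler_distl; lra.
Unshelve. all: end_near. Qed.

Lemma cvg_difference_quotient (R : realType) (f : R -> R) (x v df : R) :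
  is_derive x 1 f df -> n%:R * (f (x + v / n%:R) - f x) @[n --> \oo] --> v * df.
Proof.
move=> fx; have dfx : differentiable f x by exact/derivable1_diffP.
have fxv : derivable f x v by exact: diff_derivable.
have -> : v * df = 'D_v f x.
  rewrite -(derive_val (is_derive := fx)) !deriveE//.
  by rewrite -[in RHS](mulr1 v) -[v * 1]/(v *: 1) linearZ.
rewrite -cvg_shiftS.
have harmonic0' : harmonic n @[n --> \oo] --> (0 : R)^'.
  move=> A /(@cvg_harmonic R) [N _ AN]; exists N => // n Nn.
  by apply: (AN n Nn); rewrite gt_eqF// harmonic_gt0.
apply: cvg_trans (cvg_comp _ _ harmonic0' fxv); apply: near_eq_cvg.
apply: nearW => n /=.
by rewrite invrK /GRing.scale /= (addrC x) (mulrC v).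
Qed.

Lemma cvg_expn_expR (R : realType) (c : R) :
  (1 - c / n%:R) ^+ n @[n --> \oo] --> expR (- c).
Proof.
have d1 : is_derive (1 : R) 1 (@ln R) 1.
  by rewrite -[X in is_derive _ _ _ X]invr1; exact: is_derive1_ln.
have := cvg_difference_quotient (v := - c) d1; rewrite mulr1 ln1 => lnc.
apply: cvg_trans (continuous_cvg _ (@continuous_expR R _) lnc).
apply: near_eq_cvg; near=> n.
have n0 : 0 < n%:R :> R by rewrite ltr0n; near: n; exact: nbhs_infty_gt.
rewrite /= subr0 mulNr expRM_natl lnK// posrE subr_gt0 ltr_pdivrMr// mul1r.
by near: n; exact: nbhs_infty_gtr.
Unshelve. all: end_near. Qed.

Lemma cvg_onem_expR (R : realType) (v : R) :
  n%:R * (1 - expR (- (v / n%:R))) @[n --> \oo] --> v.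
Proof.
have d0 : is_derive (0 : R) 1 (@expR R) 1.
  by have := is_derive_expR (0 : R); rewrite expR0.
rewrite -[X in _ --> X]opprK -[in X in _ --> X](mulr1 (- v)).
rewrite (_ : (fun n : nat => _) =
    - (fun n : nat => n%:R * (expR (0 + - v / n%:R) - expR 0))).
  by apply: cvgN; exact: cvg_difference_quotient.
by apply/funext => n; rewrite opprfctE add0r expR0 mulNr; ring.
Qed.

Lemma cvg_continuous_perturb (R : realType) (F : R -> R) (t : R) (u : R^nat) :
  continuous F -> u k @[k --> \oo] --> 0 -> F (t + u k) @[k --> \oo] --> F t.
Proof.
move=> cF u0; apply: (continuous_cvg _ (cF t)).
by rewrite -[X in _ --> X]addr0; apply: cvgD => //; exact: cvg_cst.
Qed.

Lemma cvg_continuous_harmonicl (R : realType) (F : R -> R) (t : R) :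
  continuous F -> F (t - harmonic k) @[k --> \oo] --> F t.
Proof.
move=> cF; apply: cvg_continuous_perturb => //.
by rewrite -oppr0; apply: cvgN; exact: cvg_harmonic.
Qed.

Lemma cvg_continuous_harmonicr (R : realType) (F : R -> R) (t : R) :
  continuous F -> F (t + harmonic k) @[k --> \oo] --> F t.
Proof.
by move=> cF; apply: cvg_continuous_perturb => //; exact: cvg_harmonic.
Qed.

Lemma cvg_sum_ord_same_lim (R : realType) K (f : 'I_K -> R^nat) (l : R) :
  (forall k, f k n @[n --> \oo] --> l) ->
  \sum_(k < K) f k n @[n --> \oo] --> K%:R * l.
Proof.
move=> fl; rewrite mulr_natl -[in X in _ --> X](card_ord K) -sumr_const.
by apply: cvg_big => // ?; exact: add_continuous.
Qed.

Section measurability.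
Context d (T : measurableType d) (R : realType).
Implicit Types f g : T -> R.

Lemma measurable_set_ler f g : measurable_fun setT f -> measurable_fun setT g ->
  measurable [set w | f w <= g w].
Proof.
by move=> mf mg; rewrite -[X in measurable X]setTI; exact: measurable_fun_le.
Qed.

Lemma measurable_set_ltr f g : measurable_fun setT f -> measurable_fun setT g ->
  measurable [set w | f w < g w].
Proof.
move=> mf mg; rewrite (_ : mkset _ = ~` [set w | g w <= f w]).
  exact/measurableC/measurable_set_ler.
by apply/seteqP; split => w /=; rewrite ltNge => /negP.
Qed.

Lemma measurable_superlevel f c : measurable_fun setT f ->
  measurable [set w | c <= f w].
Proof. exact: measurable_set_ler. Qed.

Lemma measurable_strict_superlevel f c : measurable_fun setT f ->
  measurable [set w | c < f w].
Proof. exact: measurable_set_ltr. Qed.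

Lemma measurable_sublevel f c : measurable_fun setT f ->
  measurable [set w | f w <= c].
Proof. by move=> mf; apply: measurable_set_ler. Qed.

Lemma measurable_strict_sublevel f c : measurable_fun setT f ->
  measurable [set w | f w < c].
Proof. by move=> mf; apply: measurable_set_ltr. Qed.

Lemma measurable_invr f : measurable_fun setT f ->
  measurable_fun setT (fun w => (f w)^-1).
Proof.
move=> mf; apply: (measurableT_comp _ mf).
have m0 : measurable [set 0 : R] by exact: measurable_set1.
rewrite -(setvU [set 0 : R]); apply/measurable_funU => //.
  exact: measurableC.
split.
  apply: subspace_continuous_measurable_fun; first exact: measurableC.
  apply: continuous_in_subspaceT => x; rewrite inE/= => /eqP x0.
  exact: inv_continuous.
apply: (eq_measurable_fun (cst (0 : R))) => [x|]; last exact: measurable_cst.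
by rewrite inE/= => ->; rewrite invr0.
Qed.

Lemma measurable_divr f g : measurable_fun setT f -> measurable_fun setT g ->
  measurable_fun setT (fun w => f w / g w).
Proof.
by move=> mf mg; apply: measurable_funM => //; exact: measurable_invr.
Qed.

Lemma measurable_max_upto n (f : nat -> T -> R) :
  (forall i, measurable_fun setT (f i)) ->
  measurable_fun setT (fun w => max_upto n (fun i => f i w)).
Proof.
move=> mf; rewrite /max_upto; have := mf 0%N.
move: (f 0%N) => b mb; elim: n f mf => [|n IH] f mf.
  by under eq_fun do rewrite big_ord0.
under eq_fun do rewrite big_ord_recl /=.
by apply: measurable_maxr => //; exact: (IH (fun i => f i.+1)).
Qed.

Lemma measurable_max_ratio n (X Y : nat -> T -> R) :
  (forall i, measurable_fun setT (X i)) ->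
  (forall i, measurable_fun setT (Y i)) ->
  measurable_fun setT (fun w => max_upto n (fun i => Y i w / X i w)).
Proof.
move=> mX mY.
apply: (measurable_max_upto n (f := fun i w => Y i w / X i w)) => i.
exact: measurable_divr.
Qed.

End measurability.

Section real_probability.
Context d (T : measurableType d) (R : realType) (P : probability T R).
Local Notation pr A := (fine (P A)).
Implicit Types A B : set T.

Lemma prE A : measurable A -> P A = (pr A)%:E.
Proof. by move=> mA; rewrite fineK// fin_num_measure. Qed.

Lemma pr_ge0 A : 0 <= pr A.
Proof. exact: fine_ge0. Qed.

Lemma pr_setT : pr [set: T] = 1.
Proof. by rewrite probability_setT. Qed.

Lemma le_pr A B : measurable A -> measurable B -> A `<=` B -> pr A <= pr B.
Proof.
by move=> mA mB AB; rewrite -lee_fin -!prE//; apply: le_measure; rewrite ?inE.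
Qed.

Lemma ae_le_pr A B : measurable A -> measurable B ->
  {ae P, forall w, A w -> B w} -> pr A <= pr B.
Proof.
move=> mA mB [N [mN N0 AB]]; have <- : pr (B `|` N) = pr B.
  by rewrite measureU0.
apply: le_pr => //; first exact: measurableU.
move=> w Aw; have [Bw|nBw] := pselect (B w); first by left.
by right; apply: AB => /(_ Aw).
Qed.

Lemma ae_eq_pr A B : measurable A -> measurable B ->
  {ae P, forall w, A w <-> B w} -> pr A = pr B.
Proof.
move=> mA mB AB; apply/eqP; rewrite eq_le.
by apply/andP; split; apply: ae_le_pr => //; apply: filterS AB => w [].
Qed.

Lemma prC A : measurable A -> pr (~` A) = 1 - pr A.
Proof. by move=> mA; rewrite probability_setC// prE. Qed.

Lemma prD A B : measurable A -> measurable B ->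
  pr (A `\` B) = pr A - pr (A `&` B).
Proof.
move=> mA mB; apply: EFin_inj; rewrite EFinB -!prE//.
- by rewrite measureD// -ge0_fin_numE// fin_num_measure.
- exact: measurableI.
- exact: measurableD.
Qed.

Lemma le_prU A B C : measurable A -> measurable B -> measurable C ->
  A `<=` B `|` C -> pr A <= pr B + pr C.
Proof.
move=> mA mB mC ABC; have mBC := measurableU _ _ mB mC.
apply: le_trans (le_pr mA mBC ABC) _.
by rewrite -lee_fin EFinD -!prE//; exact: measureU2.
Qed.

Lemma cvg_prP (E : nat -> set T) (l : R) : (forall n, measurable (E n)) ->
  pr (E n) @[n --> \oo] --> l <-> P (E n) @[n --> \oo] --> l%:E.
Proof.
move=> mE; split => [|/fine_cvg//].
by apply: cvg_EFin; apply: nearW => n; exact: fin_num_measure.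
Qed.

End real_probability.

Section convergence_in_distribution.
Context d (T : measurableType d) (R : realType) (P : probability T R).
Local Notation pr A := (fine (P A)).
Implicit Types (Z W : nat -> T -> R) (F : R -> R).

Definition tight_above Z : Prop := forall e, 0 < e ->
  exists c, \forall n \near \oo, pr [set w | c < Z n w] <= e.

Definition cvg_in_probability0 W : Prop := forall e, 0 < e ->
  pr [set w | e < `|W n w|] @[n --> \oo] --> 0.

Let measurable_gt_norm (f : T -> R) c : measurable_fun setT f ->
  measurable [set w | c < `|f w|].
Proof.
move=> mf; apply: measurable_strict_superlevel.
exact: (measurableT_comp (@normr_measurable R setT) mf).
Qed.

Lemma cvg_in_distribution_lt Z F : continuous F ->
  (forall n, measurable_fun setT (Z n)) ->
  (forall t, pr [set w | Z n w < t] @[n --> \oo] --> F t) ->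
  cvg_in_distribution P Z F.
Proof.
move=> cF mZ ZF t _; apply/cvg_prP => [n|]; first exact: measurable_sublevel.
apply: (cvg_double_squeeze (l := fun _ n => pr [set w | Z n w < t])
  (u := fun K n => pr [set w | Z n w < t + harmonic K])).
- move=> K; apply: nearW => n; apply/andP; split; apply: le_pr => //.
  + exact: measurable_strict_sublevel.
  + exact: measurable_sublevel.
  + by move=> w /ltW.
  + exact: measurable_sublevel.
  + exact: measurable_strict_sublevel.
  + by move=> w /= /le_lt_trans; apply; rewrite ltrDl harmonic_gt0.
- by move=> K; exact: ZF.
- exact: cvg_cst.
- by move=> K; exact: ZF.
- exact: cvg_continuous_harmonicr.
Qed.

Lemma cvg_in_distribution_slutsky Z W F : continuous F ->
  (forall n, measurable_fun setT (Z n)) ->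
  (forall n, measurable_fun setT (W n)) ->
  cvg_in_distribution P Z F -> cvg_in_probability0 (fun n w => W n w - Z n w) ->
  cvg_in_distribution P W F.
Proof.
move=> cF mZ mW ZF WZ t _.
apply/cvg_prP => [n|]; first exact: measurable_sublevel.
have mWZ n : measurable_fun setT (fun w => W n w - Z n w).
  exact: measurable_funB.
have prZF s : pr [set w | Z n w <= s] @[n --> \oo] --> F s.
  by apply/cvg_prP; [move=> n; exact: measurable_sublevel|exact: ZF (cF s)].
pose far K n := [set w | harmonic K < `|W n w - Z n w|].
have mfar K n : measurable (far K n) by exact: measurable_gt_norm.
have far0 K : pr (far K n) @[n --> \oo] --> 0.
  by apply: WZ; exact: harmonic_gt0.
have near_or_far K n w : far K n w \/
    W n w <= Z n w + harmonic K /\ Z n w <= W n w + harmonic K.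
  rewrite /far /mkset; case: ltP => [|WZ_near]; [by left|right].
  by move: WZ_near; rewrite ler_distl lerBlDr => /andP[].
apply: (cvg_double_squeeze
  (l := fun K n => pr [set w | Z n w <= t - harmonic K] - pr (far K n))
  (u := fun K n => pr [set w | Z n w <= t + harmonic K] + pr (far K n))).
- move=> K; apply: nearW => n; rewrite lerBlDr; apply/andP.
  split; apply: le_prU => //; try exact: measurable_sublevel.
    move=> w Z_le; case: (near_or_far K n w) => [|[W_near _]]; [by right|left].
    by apply: le_trans W_near _; rewrite -lerBrDr.
  move=> w W_le; case: (near_or_far K n w) => [|[_ Z_near]]; [by right|left].
  by apply: le_trans Z_near _; rewrite lerD2r.
- by move=> K; apply: cvgB; [exact: prZF|exact: far0].
- by under eq_fun do rewrite subr0; exact: cvg_continuous_harmonicl.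
- by move=> K; apply: cvgD; [exact: prZF|exact: far0].
- by under eq_fun do rewrite addr0; exact: cvg_continuous_harmonicr.
Qed.

Lemma cvg_in_distribution_tight_above Z F : continuous F ->
  (forall n, measurable_fun setT (Z n)) ->
  cvg_in_distribution P Z F -> F t @[t --> +oo] --> (1 : R) -> tight_above Z.
Proof.
move=> cF mZ ZF F1 e e0; have e2 : 0 < e / 2 by rewrite divr_gt0.
have /cvgrPdist_le/(_ _ e2)/filter_ex[c] := F1.
rewrite ler_distl => /andP[_ Fc]; exists c.
have mZc n : measurable [set w | Z n w <= c] by exact: measurable_sublevel.
have /(cvg_prP P _ mZc).2/cvgrPdist_le/(_ _ e2) := ZF c (cF c).
apply: filterS => n; rewrite ler_distl => /andP[_ FZ].
rewrite (_ : [set w | c < Z n w] = ~` [set w | Z n w <= c]).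
  by rewrite prC//; lra.
by apply/seteqP; split => w /=; rewrite ltNge => /negP.
Qed.

Lemma tight_above_cvg_in_probability0 Z W :
  (forall n, measurable_fun setT (Z n)) ->
  (forall n, measurable_fun setT (W n)) ->
  tight_above Z ->
  (forall c e, 0 < e ->
     \forall n \near \oo, {ae P, forall w, Z n w <= c -> `|W n w| <= e}) ->
  cvg_in_probability0 W.
Proof.
move=> mZ mW tightZ ZW e e0; apply/cvgrPdist_le => eps eps0.
have [c Zc] := tightZ _ eps0; near=> n.
rewrite sub0r normrN ger0_norm ?pr_ge0//.
have Zcn : pr [set w | c < Z n w] <= eps by near: n.
apply: le_trans Zcn; apply: ae_le_pr; first exact: measurable_gt_norm.
  exact: measurable_strict_superlevel.
have : {ae P, forall w, Z n w <= c -> `|W n w| <= e} by near: n; exact: ZW.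
by apply: filterS => w Zc_We /=; rewrite !ltNge; exact: contra.
Unshelve. all: end_near. Qed.

End convergence_in_distribution.

Section independence.
Context d (T : measurableType d) (R : realType) (P : probability T R).
Local Notation pr A := (fine (P A)).

(* Only products over the whole index set are considered: this is the usual
   notion of independence as soon as all the [G i] contain the full set. *)
Definition independent_set_systems (I : finType) (G : I -> set (set T)) :
    Prop :=
  forall F : I -> set T, (forall i, G i (F i)) ->
    pr (\big[setI/setT]_i F i) = \prod_i pr (F i).

Lemma independent_event_g_sigma_algebra (G : set (set T)) (C : set T) :
  G `<=` measurable -> setI_closed G -> G setT -> measurable C ->
  (forall E, G E -> pr (E `&` C) = pr E * pr C) ->
  forall E, <<s G >> E -> pr (E `&` C) = pr E * pr C.
Proof.
move=> mG setIG GT mC indepC E sGE.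
have mE : measurable E.
  by apply: smallest_sub sGE; [exact: sigma_algebra_measurable|].
suff restr_scale : mrestr P mC E = mscale (NngNum (pr_ge0 P C)) P E.
  apply: EFin_inj; rewrite mulrC EFinM -(prE P mE) -prE//.
  exact: measurableI.
apply: (g_sigma_algebra_measure_unique G mG (fun=> setT)) => //.
- by apply/seteqP; split => // w _; exists 0%N.
- move=> F GF; have mF := mG _ GF.
  rewrite -[LHS]/(P (F `&` C)) -[RHS]/((pr C)%:E * P F)%E.
  by rewrite (prE P (measurableI _ _ mF mC)) indepC// (prE P mF) mulrC EFinM.
- by move=> _; rewrite /= /mrestr setTI ltey_eq fin_num_measure.
Qed.

Section pi_lambda.
Context (I : finType) (G : I -> set (set T)).
Hypotheses (mG : forall i, G i `<=` measurable)
  (setIG : forall i, setI_closed (G i)) (GT : forall i, G i setT)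
  (indepG : independent_set_systems G).

(* The coordinates are moved one at a time from the pi-systems to the generated
   sigma-algebras. *)
Lemma independent_g_sigma_algebra :
  independent_set_systems (fun i => <<s G i >>).
Proof.
suff mixed (r : seq I) (F : I -> set T) :
    (forall i, i \in r -> <<s G i >> (F i)) ->
    (forall i, i \notin r -> G i (F i)) ->
    pr (\big[setI/setT]_i F i) = \prod_i pr (F i).
  by move=> F GF; apply: (mixed (index_enum I)) => // i; rewrite mem_index_enum.
elim: r F => [|k r IH] F sGF GF; first by apply: indepG => i; exact: GF.
have sF i : <<s G i >> (F i).
  have [ir|/GF] := boolP (i \in k :: r); first exact: sGF.
  exact: sub_sigma_algebra.
have mF i : measurable (F i).
  by apply: smallest_sub (sF i); [exact: sigma_algebra_measurable|exact: mG].
set others := \big[setI/setT]_(i | i != k) F i.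
have rule E : G k E -> pr (E `&` others) = pr E * \prod_(i | i != k) pr (F i).
  move=> GE; pose FE i := if i == k then E else F i.
  have FE_k : FE k = E by rewrite /FE eqxx.
  have FE_others i : i != k -> FE i = F i by rewrite /FE => /negPf ->.
  have -> : pr E * \prod_(i | i != k) pr (F i) = \prod_i pr (FE i).
    rewrite [RHS](bigD1 k)//= FE_k; congr *%R.
    by apply: eq_bigr => i /FE_others ->.
  rewrite -IH => [|i ir|i ir].
  - rewrite (bigD1 k)//= FE_k; congr (fine (P (_ `&` _))).
    by apply: eq_bigr => i /FE_others ->.
  - by rewrite /FE; case: eqP => [->|_]; [exact: sub_sigma_algebra|exact: sF].
  - rewrite /FE; case: eqP => [->//|/eqP ik].
    by apply: GF; rewrite inE negb_or ik.
have pr_others : pr others = \prod_(i | i != k) pr (F i).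
  by have := rule _ (GT k); rewrite setTI pr_setT mul1r.
rewrite (bigD1 k)//= -/others [RHS](bigD1 k)//= -pr_others.
apply: (independent_event_g_sigma_algebra (@mG k)) => // [|E GE].
  exact: bigsetI_measurable.
by rewrite rule// pr_others.
Qed.

End pi_lambda.
End independence.

Section rectangles.
Context d (T : measurableType d) d1 (T1 : measurableType d1)
  d2 (T2 : measurableType d2).
Implicit Types (f : T -> T1) (g : T -> T2).

Definition rectangles f g : set (set T) :=
  [set E | exists A B, [/\ measurable A, measurable B &
    E = f @^-1` A `&` g @^-1` B]].

Lemma rectanglesT f g : rectangles f g setT.
Proof. by exists setT, setT; rewrite !preimage_setT setIT. Qed.

Lemma rectanglesI f g : setI_closed (rectangles f g).
Proof.
move=> _ _ [A [B [mA mB ->]]] [A' [B' [mA' mB' ->]]].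
exists (A `&` A'), (B `&` B'); rewrite !preimage_setI setIACA.
by split=> //; exact: measurableI.
Qed.

Lemma measurable_rectangles f g :
  measurable_fun setT f -> measurable_fun setT g ->
  rectangles f g `<=` measurable.
Proof.
move=> mf mg _ [A [B [mA mB ->]]].
by apply: measurableI; rewrite -[X in measurable X]setTI; [exact: mf|exact: mg].
Qed.

Lemma rectangles_measurable_fun f g :
  measurable_fun setT (f : g_sigma_algebraType (rectangles f g) -> T1) /\
  measurable_fun setT (g : g_sigma_algebraType (rectangles f g) -> T2).
Proof.
split=> _ A mA; rewrite setTI; apply: sub_sigma_algebra.
  by exists A, setT; rewrite preimage_setT setIT.
by exists setT, A; rewrite preimage_setT setTI.
Qed.

End rectangles.

Section independent_pairs.
Context d (T : measurableType d) (R : realType) (P : probability T R).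
Local Notation pr A := (fine (P A)).

Lemma pr_mutually_independent_rv (I : choiceType) (Z : I -> T -> R) (J : seq I)
    (B : I -> set R) :
  (forall i, measurable_fun setT (Z i)) -> mutually_independent_rv P Z ->
  uniq J -> (forall i, measurable (B i)) ->
  pr (\big[setI/setT]_(i <- J) (Z i @^-1` B i)) =
  \prod_(i <- J) pr (Z i @^-1` B i).
Proof.
move=> mZ indepZ uJ mB; rewrite -bigcap_seq indepZ//.
rewrite (eq_bigr (fun i => (pr (Z i @^-1` B i))%:E)) ?prodEFin// => i _.
by rewrite prE// -[X in measurable X]setTI; exact: mZ.
Qed.

Context (X Y : nat -> T -> R) (mX : forall i, measurable_fun setT (X i))
  (mY : forall i, measurable_fun setT (Y i)).
Local Notation Z := (fun k : nat * bool => if k.2 then Y k.1 else X k.1).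
Hypothesis indepXY : mutually_independent_rv P Z.

Let mZ k : measurable_fun setT (Z k).
Proof. by case: k => i [] /=. Qed.

Lemma pr_rectangle i A B : measurable A -> measurable B ->
  pr (X i @^-1` A `&` Y i @^-1` B) = pr (X i @^-1` A) * pr (Y i @^-1` B).
Proof.
move=> mA mB; pose C (k : nat * bool) := if k.2 then B else A.
have mC k : measurable (C k) by rewrite /C; case: ifP.
have uJ : uniq [:: (i, false); (i, true)] by rewrite /= inE xpair_eqE andbF.
have := pr_mutually_independent_rv mZ indepXY uJ mC.
by rewrite !big_cons !big_nil setIT mulr1.
Qed.

Lemma independent_rectangles n :
  independent_set_systems P (fun i : 'I_n => rectangles (X i) (Y i)).
Proof.
move=> F /choice[A /choice[B FAB]].
have mA i : measurable (A i) by have [] := FAB i.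
have mB i : measurable (B i) by have [] := FAB i.
have FE i : F i = X i @^-1` A i `&` Y i @^-1` B i by have [] := FAB i.
pose C (k : nat * bool) :=
  if insub k.1 is Some i then if k.2 then B i else A i else setT.
have mC k : measurable (C k) by rewrite /C; case: insubP => // i _ _; case: ifP.
pose J := [seq (val i, b) | i <- index_enum 'I_n, b <- [:: false; true]].
have uJ : uniq J.
  apply: allpairs_uniq; rewrite ?index_enum_uniq//.
  by move=> [i b] [j c] _ _ [/val_inj -> ->].
have := pr_mutually_independent_rv mZ indepXY uJ mC.
have -> : \big[setI/setT]_(j <- J) (Z j @^-1` C j) = \big[setI/setT]_i F i.
  rewrite big_allpairs_dep; apply: eq_bigr => i _.
  by rewrite !big_cons big_nil /= setIT /C /= valK FE.
move=> ->; rewrite big_allpairs_dep; apply: eq_bigr => i _.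
by rewrite !big_cons big_nil /= mulr1 FE pr_rectangle// /C /= valK.
Qed.

Lemma independent_pairs n :
  independent_set_systems P (fun i : 'I_n => <<s rectangles (X i) (Y i) >>).
Proof.
apply: independent_g_sigma_algebra => [i|i|i|].
- exact: measurable_rectangles.
- exact: rectanglesI.
- exact: rectanglesT.
- exact: independent_rectangles.
Qed.

End independent_pairs.

Definition joint_surv d (T : measurableType d) (R : realType)
    (P : probability T R) (A B : T -> R) (a b : R) : R :=
  fine (P [set w | a <= A w /\ b <= B w]).

Section staircase.
Context d (T : measurableType d) (R : realType) (P : probability T R).
Local Notation pr A := (fine (P A)).
Context (A B : T -> R).
Hypotheses (mA : measurable_fun setT A) (mB : measurable_fun setT B).
Local Notation G := (joint_surv P A B).

Lemma measurable_orthant a b : measurable [set w | a <= A w /\ b <= B w].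
Proof. by apply: measurableI; exact: measurable_superlevel. Qed.

Lemma le_pr_strip (E F : set T) a a' :
  measurable E -> measurable F -> a <= a' ->
  (forall w, a <= A w < a' -> E w -> F w) ->
  pr (E `&` [set w | a <= A w]) - pr (E `&` [set w | a' <= A w]) <=
  pr (F `&` [set w | a <= A w]) - pr (F `&` [set w | a' <= A w]).
Proof.
move=> mE mF aa' EF.
have mI D c : measurable D -> measurable (D `&` [set w | c <= A w]).
  by move=> mD; apply: measurableI => //; exact: measurable_superlevel.
have strip D : measurable D ->
    pr (D `&` [set w | a <= A w]) - pr (D `&` [set w | a' <= A w]) =
    pr ((D `&` [set w | a <= A w]) `\` [set w | a' <= A w]).
  move=> mD; rewrite prD//; [|exact: mI|exact: measurable_superlevel].
  congr (_ - fine (P _)); apply/seteqP; split=> w /=; last by move=> [[]].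
  by move=> [Dw a'A]; do 2!split => //; exact: le_trans a'A.
rewrite !strip//; apply: le_pr.
- by apply: measurableD; [exact: mI|exact: measurable_superlevel].
- by apply: measurableD; [exact: mI|exact: measurable_superlevel].
- move=> w [[Ew aA] nAa']; split => //; split => //.
  by apply: EF => //; rewrite aA ltNge; apply/negP.
Qed.

Lemma joint_survE a b :
  G a b = pr ([set w | b <= B w] `&` [set w | a <= A w]).
Proof. by rewrite setIC. Qed.

Lemma pr_slab_telescope (E : set T) (a : nat -> R) K :
  pr (E `&` [set w | a 0%N <= A w]) - pr (E `&` [set w | a K <= A w]) =
  \sum_(k < K)
    (pr (E `&` [set w | a k <= A w]) - pr (E `&` [set w | a k.+1 <= A w])).
Proof.
pose f k := - pr (E `&` [set w | a k <= A w]).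
rewrite addrC -[X in _ + X]opprK -[LHS]/(f K - f 0%N).
rewrite -telescope_sumr// big_mkord.
by apply: eq_bigr => k _; rewrite /f opprK addrC.
Qed.

(* The event [E] is cut into the strips [a k <= A w < a k.+1]; comparing [B]
   with a constant [b k] on each of them leaves only values of [G]. *)
Section slab_bounds.
Context (E : set T) (a b : nat -> R) (K : nat) (mE : measurable E).
Hypothesis a_mono : forall k, a k <= a k.+1.

Lemma pr_slab_le_staircase :
  (forall k w, a k <= A w < a k.+1 -> E w -> b k <= B w) ->
  pr (E `&` [set w | a 0%N <= A w]) - pr (E `&` [set w | a K <= A w]) <=
  \sum_(k < K) (G (a k) (b k) - G (a k.+1) (b k)).
Proof.
move=> Eb; rewrite pr_slab_telescope; apply: ler_sum => k _.
rewrite !joint_survE.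
apply: le_pr_strip => // [|w]; [exact: measurable_superlevel|exact: Eb].
Qed.

Lemma staircase_le_pr_slab :
  (forall k w, a k <= A w < a k.+1 -> b k <= B w -> E w) ->
  \sum_(k < K) (G (a k) (b k) - G (a k.+1) (b k)) <=
  pr (E `&` [set w | a 0%N <= A w]) - pr (E `&` [set w | a K <= A w]).
Proof.
move=> bE; rewrite pr_slab_telescope; apply: ler_sum => k _.
rewrite !joint_survE.
apply: le_pr_strip => // [|w]; [exact: measurable_superlevel|exact: bE].
Qed.

End slab_bounds.
End staircase.

Section exponential_race.
Context d (T : measurableType d) (R : realType) (P : probability T R).
Local Notation pr A := (fine (P A)).

Lemma pr_le_joint_surv00 (A B : T -> R) (E : set T) :
  measurable_fun setT A -> measurable_fun setT B -> measurable E ->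
  pr E <= pr (E `&` [set w | 0 <= A w /\ 0 <= B w])
          + (1 - joint_surv P A B 0 0).
Proof.
move=> mA mB mE; have mO := measurable_orthant mA mB 0 0.
have mEO := measurableI _ _ mE mO; have mO' := measurableC mO.
rewrite -prC//; apply: le_prU => // w Ew.
by have [Ow|] := pselect (0 <= A w /\ 0 <= B w); [left|right].
Qed.

Definition exponential_pair (A B : T -> R) : Prop :=
  forall a b, 0 <= a -> 0 <= b -> joint_surv P A B a b = expR (- (a + b)).

Lemma exponential_pairC A B : exponential_pair A B -> exponential_pair B A.
Proof.
move=> AB a b a0 b0; rewrite addrC -AB//; congr (fine (P _)).
by apply/seteqP; split => w [].
Qed.

Lemma exponential_pair00 A B : exponential_pair A B -> joint_surv P A B 0 0 = 1.
Proof. by move=> ->//; rewrite addr0 oppr0 expR0. Qed.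

Let measurable_race (A B : T -> R) (c : R) :
  measurable_fun setT A -> measurable_fun setT B ->
  measurable [set w | c * A w <= B w].
Proof.
move=> mA mB; apply: measurable_set_ler => //.
by apply: measurable_funM => //; exact: measurable_cst.
Qed.

Lemma pr_exponential_race_le_geometric (A B : T -> R) (c h : R) K :
  measurable_fun setT A -> measurable_fun setT B -> exponential_pair A B ->
  0 <= c -> 0 <= h ->
  pr [set w | c * A w <= B w] <=
  series (geometric (1 - expR (- h)) (expR (- ((1 + c) * h)))) K
  + expR (- ((1 + c) * h)) ^+ K.
Proof.
move=> mA mB AB c0 h0; set E := mkset _; set r := expR (- ((1 + c) * h)).
have mE : measurable E by exact: measurable_race.
pose a (k : nat) := k%:R * h.
have a0 k : 0 <= a k by rewrite mulr_ge0.
have ca0 k : 0 <= c * a k by rewrite mulr_ge0.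
have aS k : a k.+1 = a k + h by rewrite /a -natr1 mulrDl mul1r.
have rE k : expR (- (a k + c * a k)) = r ^+ k.
  by rewrite /r -expRM_natl; congr expR; rewrite /a; ring.
apply: le_trans (pr_le_joint_surv00 mA mB mE) _.
rewrite (exponential_pair00 AB) subrr addr0.
have stair :
    pr (E `&` [set w | a 0%N <= A w]) - pr (E `&` [set w | a K <= A w]) <=
    series (geometric (1 - expR (- h)) r) K.
  have le_stair := pr_slab_le_staircase (b := fun k => c * a k) P mA mB K mE.
  apply: le_trans (le_stair _ _ _) _.
  - by move=> k; rewrite aS lerDl.
  - by move=> k w /andP[aA _]; apply: le_trans; rewrite ler_wpM2l.
  - rewrite seriesEord /=; apply: ler_sum => k _.
    by rewrite !AB// aS addrAC [in X in _ - X]opprD expRD rE; lra.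
have tail : pr (E `&` [set w | a K <= A w]) <= r ^+ K.
  rewrite -rE -AB//; apply: le_pr.
  - by apply: measurableI => //; exact: measurable_superlevel.
  - exact: measurable_orthant.
  - by move=> w [Ew aA]; split => //; apply: le_trans Ew; rewrite ler_wpM2l.
apply: (@le_trans _ _ (pr (E `&` [set w | a 0%N <= A w]))); last by lra.
apply: le_pr.
- by apply: measurableI => //; exact: measurable_orthant.
- by apply: measurableI => //; exact: measurable_superlevel.
- by move=> w [Ew [A0 _]]; split => //; rewrite /a mul0r.
Qed.

Lemma pr_exponential_race_le (A B : T -> R) (c : R) :
  measurable_fun setT A -> measurable_fun setT B -> exponential_pair A B ->
  0 <= c -> pr [set w | c * A w <= B w] <= (1 + c)^-1.
Proof.
move=> mA mB AB c0; set p := pr _; have c1 : 0 < 1 + c by rewrite ltr_wpDr.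
have mesh h : 0 < h -> p * (1 - expR (- ((1 + c) * h))) <= 1 - expR (- h).
  move=> h0; set r := expR _.
  have r1 : r < 1 by rewrite expR_lt1 oppr_lt0 mulr_gt0.
  have nr : `|r| < 1 by rewrite ger0_norm// expR_ge0.
  rewrite -ler_pdivlMr ?subr_gt0// -[leRHS]addr0.
  have geometric_cvg := @cvg_geometric_series _ (1 - expR (- h)) _ nr.
  apply: cvgr_to_ge (cvgD geometric_cvg (cvg_expr nr)) _; apply: nearW => K.
  by apply: pr_exponential_race_le_geometric => //; exact: ltW.
rewrite -[leRHS]mul1r ler_pdivlMr//.
have scaled_cvg : p * (n%:R * (1 - expR (- ((1 + c) / n%:R)))) @[n --> \oo]
    --> p * (1 + c).
  by apply: cvgM; [exact: cvg_cst|exact: cvg_onem_expR].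
apply: (ler_cvg_to scaled_cvg (@cvg_onem_expR R 1)).
near=> n; rewrite /= mulrCA ler_wpM2l// mul1r mesh// invr_gt0 ltr0n.
by near: n; exact: nbhs_infty_gt.
Unshelve. all: end_near. Qed.

(* Only the upper bound needs a computation: applied to [(B, A)] and [c^-1] it
   also bounds the complementary event. *)
Lemma pr_exponential_race (A B : T -> R) (c : R) :
  measurable_fun setT A -> measurable_fun setT B -> exponential_pair A B ->
  0 <= c -> pr [set w | c * A w <= B w] = (1 + c)^-1.
Proof.
move=> mA mB AB; rewrite le_eqVlt => /predU1P[<-|c0].
  apply/eqP; rewrite eq_le pr_exponential_race_le//= addr0 invr1.
  rewrite -(exponential_pair00 AB).
  apply: le_pr; [exact: measurable_orthant|exact: measurable_race|].
  by move=> w [_ B0]; rewrite /= mul0r.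
apply/eqP; rewrite eq_le pr_exponential_race_le ?(ltW c0)//=.
have cV0 : 0 <= c^-1 by rewrite invr_ge0 ltW.
have := pr_exponential_race_le mB mA (exponential_pairC AB) cV0.
have : pr setT <= pr [set w | c * A w <= B w] + pr [set w | c^-1 * B w <= A w].
  apply: le_prU => //; try exact: measurable_race; move=> w _.
  have [|/ltW BcA] := leP (c * A w) (B w); [by left|right].
  by rewrite /= ler_pdivrMl.
rewrite pr_setT (_ : (1 + c^-1)^-1 = 1 - (1 + c)^-1); first by lra.
by field; rewrite !gt_eqF// addr_gt0.
Qed.

End exponential_race.

Section grid.
Context (R : realType).
Implicit Types (t : R) (K k : nat).

Definition grid t K k : R := k%:R * (t / K.+1%:R).

Lemma grid0 t K : grid t K 0 = 0.
Proof. by rewrite /grid mul0r. Qed.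

Lemma gridS t K k : grid t K k.+1 = grid t K k + t / K.+1%:R.
Proof. by rewrite /grid -natr1 mulrDl mul1r. Qed.

Lemma grid_end t K : grid t K K.+1 = t.
Proof. by rewrite /grid; field. Qed.

Lemma ler_grid t K j k : 0 <= t -> (j <= k)%N -> grid t K j <= grid t K k.
Proof. by move=> t0 jk; rewrite ler_wpM2r ?divr_ge0// ler_nat. Qed.

Lemma grid_ge0 t K k : 0 <= t -> 0 <= grid t K k.
Proof. by move=> t0; rewrite -(grid0 t K) ler_grid. Qed.

Lemma grid_le t K k : 0 <= t -> (k <= K.+1)%N -> grid t K k <= t.
Proof. by move=> t0 kK; rewrite -[leRHS](grid_end t K) ler_grid. Qed.

End grid.

Section sum_tail.
Context d (T : measurableType d) (R : realType) (P : probability T R).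
Local Notation pr A := (fine (P A)).
Local Notation G := (joint_surv P).

Definition lower_staircase (A B : T -> R) (t : R) (K : nat) : R :=
  G A B t 0 + \sum_(k < K.+1)
    (G A B (grid t K k) (t - grid t K k) -
     G A B (grid t K k.+1) (t - grid t K k)).

Definition upper_staircase (A B : T -> R) (t : R) (K : nat) : R :=
  G A B t 0 + \sum_(k < K.+1)
    (G A B (grid t K k) (t - grid t K k.+1) -
     G A B (grid t K k.+1) (t - grid t K k.+1)).

Lemma lower_staircase_le_pr_sum (A B : T -> R) t K :
  measurable_fun setT A -> measurable_fun setT B -> 0 <= t ->
  lower_staircase A B t K <= pr [set w | t <= A w + B w].
Proof.
move=> mA mB t0; set E := mkset _.
have mE : measurable E by apply: measurable_superlevel; exact: measurable_funD.
have mEA c : measurable (E `&` [set w | c <= A w]).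
  by apply: measurableI => //; exact: measurable_superlevel.
have stair := @staircase_le_pr_slab _ _ _ P _ _ mA mB E (grid t K)
  (fun k => t - grid t K k) K.+1 mE.
apply: le_trans (le_pr P (mEA (grid t K 0)) mE _); last by move=> w [].
rewrite -lerBrDl; apply: le_trans (stair _ _) _.
- by move=> k; rewrite ler_grid.
- by move=> k w /andP[aA _]; rewrite /E /=; lra.
- rewrite lerD2l lerN2; apply: le_pr => //; first exact: measurable_orthant.
  by move=> w [tA B0]; rewrite /E /= grid_end; split => //=; lra.
Qed.

Lemma pr_sum_le_upper_staircase (A B : T -> R) t K :
  measurable_fun setT A -> measurable_fun setT B -> 0 <= t ->
  pr [set w | t <= A w + B w] <= upper_staircase A B t K + (1 - G A B 0 0).
Proof.
move=> mA mB t0; set E := mkset _.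
have mE : measurable E by apply: measurable_superlevel; exact: measurable_funD.
pose EB := E `&` [set w | 0 <= B w].
have mEB : measurable EB.
  by apply: measurableI => //; exact: measurable_superlevel.
have mEBA c : measurable (EB `&` [set w | c <= A w]).
  by apply: measurableI => //; exact: measurable_superlevel.
apply: le_trans (pr_le_joint_surv00 P mA mB mE) _; rewrite lerD2r.
have stair := @pr_slab_le_staircase _ _ _ P _ _ mA mB EB (grid t K)
  (fun k => t - grid t K k.+1) K.+1 mEB.
apply: le_trans (le_pr P _ (mEBA (grid t K 0)) _) _.
- by apply: measurableI => //; exact: measurable_orthant.
- by move=> w [Ew [A0 B0]]; split => //=; rewrite grid0.
rewrite -lerBlDl; apply: le_trans (stair _ _).
- rewrite lerD2l lerN2; apply: le_pr => //; first exact: measurable_orthant.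
  by move=> w [[_ B0]]; rewrite /= grid_end.
- by move=> k; rewrite ler_grid.
- by move=> k w /andP[_ Aa] [Ew _]; move: Ew; rewrite /E /=; lra.
Qed.

Section staircase_limit.
Context (A B : nat -> T -> R) (g : R -> R) (t : R).
Hypothesis t0 : 0 <= t.
Hypothesis ABg : forall a b, 0 <= a -> 0 <= b ->
  G (A n) (B n) a b @[n --> \oo] --> g (a + b).

Let cvgG a b s : 0 <= a -> 0 <= b -> s = a + b ->
  G (A n) (B n) a b @[n --> \oo] --> g s.
Proof. by move=> a0 b0 ->; exact: ABg. Qed.

Lemma cvg_lower_staircase K : lower_staircase (A n) (B n) t K @[n --> \oo] -->
  g t - K.+1%:R * (g (t + t / K.+1%:R) - g t).
Proof.
rewrite -mulrN opprB; apply: cvgD; first by apply: cvgG; rewrite ?addr0.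
apply: (cvg_sum_ord_same_lim (f := fun k n => _)) => k.
have kt : grid t K k <= t by rewrite grid_le// ltnW.
by apply: cvgB; apply: cvgG; rewrite ?grid_ge0 ?subr_ge0// ?gridS; ring.
Qed.

Lemma cvg_upper_staircase K : upper_staircase (A n) (B n) t K @[n --> \oo] -->
  g t + K.+1%:R * (g (t - t / K.+1%:R) - g t).
Proof.
apply: cvgD; first by apply: cvgG; rewrite ?addr0.
apply: (cvg_sum_ord_same_lim (f := fun k n => _)) => k.
have kt : grid t K k.+1 <= t by rewrite grid_le.
by apply: cvgB; apply: cvgG; rewrite ?grid_ge0 ?subr_ge0// ?gridS; ring.
Qed.

(* In the limit the strip of [A] at [s], for [0 <= s <= t], contributes
   [- g^`() (s + (t - s)) ds], and [g t] is the mass of [t <= A]. *)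
Lemma cvg_pr_sum_ge (dg : R) :
  (forall n, measurable_fun setT (A n)) ->
  (forall n, measurable_fun setT (B n)) ->
  g 0 = 1 -> is_derive t 1 g dg ->
  pr [set w | t <= A n w + B n w] @[n --> \oo] --> g t - t * dg.
Proof.
move=> mA mB g0 gt.
have quotient v :
    K.+1%:R * (g (t + v / K.+1%:R) - g t) @[K --> \oo] --> v * dg.
  by have := cvg_difference_quotient (v := v) gt; rewrite -cvg_shiftS.
apply: (cvg_double_squeeze (l := fun K n => lower_staircase (A n) (B n) t K)
  (u := fun K n => upper_staircase (A n) (B n) t K + (1 - G (A n) (B n) 0 0))).
- move=> K; apply: nearW => n; apply/andP; split.
    exact: lower_staircase_le_pr_sum.
  exact: pr_sum_le_upper_staircase.
- exact: cvg_lower_staircase.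
- by apply: cvgB; [exact: cvg_cst|exact: quotient].
- move=> K; apply: cvgD; first exact: cvg_upper_staircase.
  by apply: cvgB; [exact: cvg_cst|apply: ABg].
- rewrite addr0 g0 subrr -mulNr; under eq_fun do rewrite addr0 -mulNr.
  by apply: cvgD; [exact: cvg_cst|exact: quotient].
Qed.

End staircase_limit.
End sum_tail.

Section gamma21.
Context (R : realType).
Implicit Types t : R.

Definition gamma21_surv t : R := (1 + t) * expR (- t).

Lemma is_derive_gamma21_surv t :
  is_derive t 1 gamma21_surv (- (t * expR (- t))).
Proof.
by rewrite /gamma21_surv; apply: is_derive_eq; rewrite /GRing.scale /=; ring.
Qed.

Lemma continuous_gamma21_surv : continuous gamma21_surv.
Proof.
move=> t; have dt := is_derive_gamma21_surv t.
exact/differentiable_continuous/derivable1_diffP.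
Qed.

Lemma gamma21_surv0 : gamma21_surv 0 = 1.
Proof. by rewrite /gamma21_surv addr0 oppr0 expR0 mulr1. Qed.

Lemma cvgy_gamma21_surv : gamma21_surv t @[t --> +oo] --> (0 : R).
Proof.
apply: (@squeeze_cvgr _ _ _ _ (fun=> 0) (fun t => 2 * expR (- (t / 2)))).
- near=> t; have t0 : 0 <= t by near: t; exact: nbhs_pinfty_ge.
  rewrite /gamma21_surv mulr_ge0 ?expR_ge0 ?addr_ge0//=.
  rewrite [X in expR (- X)](_ : t = t / 2 + t / 2); last by field.
  rewrite opprD expRD mulrA ler_wpM2r ?expR_ge0//.
  rewrite expRN ler_pdivrMr ?expR_gt0//.
  by have := expR_ge1Dx (t / 2); lra.
- exact: cvg_cst.
- rewrite -[X in _ --> X](mulr0 2); apply: cvgM; first exact: cvg_cst.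
  apply: (cvg_comp (fun t => t / 2) (fun t => expR (- t))).
    by apply: gt0_cvgMly; [rewrite invr_gt0|exact: cvg_id].
  exact: cvgr_expR.
Unshelve. all: end_near. Qed.

Lemma gamma21_cdfE t : gamma21_cdf t = 1 - gamma21_surv (Num.max 0 t).
Proof.
have [t_lt0|t_gt0|->] := ltgtP t 0.
- rewrite gamma21_surv0 subrr /gamma21_cdf set_itv_ge ?Rintegral_set0//.
  by rewrite bnd_simp -ltNge.
- pose F (s : R) : R := - gamma21_surv s.
  have dF (s : R) : is_derive s 1 F (s * expR (- s)).
    rewrite -[X in is_derive _ _ _ X]opprK.
    exact: (is_deriveN (is_derive_gamma21_surv s)).
  have cF : continuous F.
    by move=> s; apply: cvgN; exact: continuous_gamma21_surv.
  rewrite /gamma21_cdf /Rintegral (@continuous_FTC2 _ _ F) //=.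
  + by rewrite /F gamma21_surv0; ring.
  + apply: continuous_subspaceT => s; apply: cvgM; first exact: cvg_id.
    apply: (continuous_comp (f := -%R) (g := expR)).
      exact: opp_continuous.
    exact: continuous_expR.
  + split => [s _||]; first exact: ex_derive.
      exact/cvg_at_right_filter/cF.
    exact/cvg_at_left_filter/cF.
  + by move=> s _; rewrite derive1E derive_val.
- by rewrite /gamma21_cdf set_itv1 Rintegral_set1 gamma21_surv0 subrr.
Qed.

Lemma continuous_gamma21_cdf : continuous (@gamma21_cdf R).
Proof.
rewrite (funext gamma21_cdfE) => t; apply: cvgB; first exact: cvg_cst.
apply: (continuous_cvg _ (@continuous_gamma21_surv (Num.max 0 t))).
by apply: (@continuous_max _ _ (cst 0) id); [exact: cvg_cst|exact: cvg_id].
Qed.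

Lemma cvgy_gamma21_cdf : gamma21_cdf t @[t --> +oo] --> (1 : R).
Proof.
have onem_surv : 1 - gamma21_surv t @[t --> +oo] --> (1 - 0 : R).
  by apply: cvgB; [exact: cvg_cst|exact: cvgy_gamma21_surv].
rewrite subr0 in onem_surv; apply: cvg_trans onem_surv.
apply: near_eq_cvg; near=> t.
by rewrite gamma21_cdfE max_r.
Unshelve. all: end_near. Qed.

End gamma21.

Definition share (R : fieldType) (x y : R) : R := x / (x + y).

Lemma measurable_share d (T : measurableType d) (R : realType) (X Y : T -> R) :
  measurable_fun setT X -> measurable_fun setT Y ->
  measurable_fun setT (fun w => share (X w) (Y w)).
Proof.
by move=> mX mY; apply: measurable_divr => //; exact: measurable_funD.
Qed.

Section share_law.
Context d (T : measurableType d) (R : realType) (P : probability T R).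
Local Notation pr A := (fine (P A)).

Lemma pr_share_ge (X Y : T -> R) (s : R) :
  measurable_fun setT X -> measurable_fun setT Y ->
  {ae P, forall w, 0 < X w /\ 0 < Y w} ->
  exponential_pair P (fun w => (X w)^-1) (fun w => (Y w)^-1) ->
  0 <= s < 1 -> pr [set w | s <= share (X w) (Y w)] = 1 - s.
Proof.
move=> mX mY XY_gt0 XY_exp /andP[s0 s1].
have c0 : 0 <= s / (1 - s) by rewrite divr_ge0//; lra.
have mXV := measurable_invr mX; have mYV := measurable_invr mY.
have -> : 1 - s = (1 + s / (1 - s))^-1 by field; lra.
rewrite -(pr_exponential_race mXV mYV XY_exp c0); apply: ae_eq_pr.
- exact/measurable_superlevel/measurable_share.
- apply: measurable_set_ler => //.
  by apply: measurable_funM => //; exact: measurable_cst.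
- apply: filterS XY_gt0 => w [X0 Y0] /=.
  rewrite /share ler_pdivlMr ?addr_gt0// mulrAC ler_pdivrMr ?subr_gt0//.
  rewrite ler_pdivrMr// -mulrA ler_pdivlMl//.
  by split; lra.
Qed.

Lemma pr_shares_ge (X Y : T -> R) (s t : R) :
  measurable_fun setT X -> measurable_fun setT Y ->
  {ae P, forall w, 0 < X w /\ 0 < Y w} ->
  exponential_pair P (fun w => (X w)^-1) (fun w => (Y w)^-1) ->
  0 <= s -> 0 <= t -> s + t < 1 ->
  pr [set w | s <= share (X w) (Y w) /\ t <= share (Y w) (X w)] = 1 - (s + t).
Proof.
move=> mX mY XY_gt0 XY_exp s0 t0 st1.
set S := [set w | s <= share (X w) (Y w)].
set S' := [set w | t <= share (Y w) (X w)].
rewrite -[mkset _]/(S `&` S').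
have mS : measurable S by exact/measurable_superlevel/measurable_share.
have mS' : measurable S' by exact/measurable_superlevel/measurable_share.
have prS : pr S = 1 - s by rewrite (pr_share_ge mX mY)//; lra.
have prS' : pr S' = 1 - t.
  rewrite (pr_share_ge mY mX)//; [|exact: exponential_pairC|lra].
  by apply: filterS XY_gt0 => w [].
have diffE : pr (S `\` S') = pr (~` S').
  apply: ae_eq_pr; [exact: measurableD|exact: measurableC|].
  apply: filterS XY_gt0 => w [X0 Y0]; split => [[]//|nS']; split => //.
  have : share (Y w) (X w) < t by rewrite ltNge; apply/negP.
  have : share (X w) (Y w) + share (Y w) (X w) = 1.
    by rewrite /share; field; rewrite !gt_eqF// addr_gt0.
  by rewrite /S /=; lra.
have := prD P mS mS'; rewrite diffE prC// prS prS'; lra.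
Qed.

End share_law.

Section frechet.
Context d (T : measurableType d) (R : realType) (P : probability T R).
Local Notation pr A := (fine (P A)).
Context (X : T -> R) (mX : measurable_fun setT X).
Hypothesis cdfX : forall x, P [set w | X w <= x] = (frechet_cdf x)%:E.

Lemma ae_frechet_gt0 : {ae P, forall w, 0 < X w}.
Proof.
exists [set w | X w <= 0]; split.
- exact: measurable_sublevel.
- by rewrite cdfX /frechet_cdf ltxx.
- by move=> w /= /negP; rewrite -leNgt.
Qed.

Lemma pr_frechet_inv_ge (a : R) : 0 <= a ->
  pr [set w | a <= (X w)^-1] = expR (- a).
Proof.
have mge b : measurable [set w | b <= (X w)^-1].
  by apply: measurable_superlevel; exact: measurable_invr.
rewrite le_eqVlt => /predU1P[<-|a0].
  rewrite oppr0 expR0 -(pr_setT P).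
  apply: ae_eq_pr => //; apply: filterS ae_frechet_gt0 => w X0.
  by split => // _; rewrite /= invr_ge0 ltW.
have -> : expR (- a) = pr [set w | X w <= a^-1].
  by rewrite cdfX /frechet_cdf invr_gt0 a0 invrK.
apply: ae_eq_pr => //.
  exact: measurable_sublevel.
apply: filterS ae_frechet_gt0 => w X0 /=.
by rewrite -[a in a <= _]invrK lef_pV2// posrE invr_gt0.
Qed.

End frechet.

Lemma le_max_upto (R : realType) n (f : nat -> R) i : (i < n)%N ->
  f i <= max_upto n f.
Proof. by move=> ni; exact: (le_bigmax _ _ (Ordinal ni)). Qed.

Lemma max_upto_attained (R : realType) n (f : nat -> R) : (0 < n)%N ->
  exists2 i, (i < n)%N & max_upto n f = f i.
Proof.
move=> n0; rewrite /max_upto.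
elim/big_ind : _ => [|x y [i ni ->] [j nj ->]|i _].
- by exists 0%N.
- by case: leP => _; [exists j|exists i].
- by exists i.
Qed.

(* Since [y i / x i + 1] is the inverse of [share (x i) (y i)], this is [n]
   times the least of the first [n] shares. *)
Definition scaled_min_share (R : realType) (n : nat) (x y : nat -> R) : R :=
  n%:R / (max_upto n (fun i => y i / x i) + 1).

(* In other words [n] times [1 - r], where [r] is the range of the shares. *)
Definition min_share_sum (R : realType) (n : nat) (x y : nat -> R) : R :=
  scaled_min_share n x y + scaled_min_share n y x.

Section scaled_min_share.
Context (R : realType) (n : nat) (x y : nat -> R).
Hypotheses (x_gt0 : forall i, 0 < x i) (y_gt0 : forall i, 0 < y i).

Lemma max_ratio_gt0 : (0 < n)%N -> 0 < max_upto n (fun i => y i / x i).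
Proof.
by move=> /(max_upto_attained (fun i => y i / x i))[i _ ->]; exact: divr_gt0.
Qed.

Lemma scaled_min_share_ge0 : 0 <= scaled_min_share n x y.
Proof.
rewrite /scaled_min_share; have [->|n_gt0] := posnP n; first by rewrite mul0r.
by rewrite divr_ge0// addr_ge0// ltW// max_ratio_gt0.
Qed.

Lemma le_scaled_min_share a : (0 < n)%N -> 0 <= a ->
  a <= scaled_min_share n x y <->
  forall i, (i < n)%N -> a / n%:R <= share (x i) (y i).
Proof.
move=> n_gt0 a0; have nR : 0 < n%:R :> R by rewrite ltr0n.
have shareE i : (a / n%:R <= share (x i) (y i)) = (a * (y i / x i + 1) <= n%:R).
  have -> : share (x i) (y i) = (y i / x i + 1)^-1.
    by rewrite /share; field; rewrite !gt_eqF// addr_gt0.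
  by rewrite ler_pdivrMr// ler_pdivlMl ?addr_gt0 ?divr_gt0// mulrC.
rewrite /scaled_min_share ler_pdivlMr ?addr_gt0 ?max_ratio_gt0//.
split => [aM i ni|a_le].
  rewrite shareE; apply: le_trans aM; rewrite ler_wpM2l// lerD2r.
  exact: (le_max_upto (fun i => y i / x i)).
have [i ni ->] := max_upto_attained (fun i => y i / x i) n_gt0.
by rewrite -shareE a_le.
Qed.

Lemma max_ratio_le_scaled_min_share a : (0 < n)%N -> 0 < a ->
  (n%:R^-1 * (max_upto n (fun i => y i / x i) + 1) <= a) =
  (a^-1 <= scaled_min_share n x y).
Proof.
move=> n_gt0 a0; have M0 := max_ratio_gt0 n_gt0.
rewrite /scaled_min_share -[n%:R / _]invrK invf_div lef_pV2.
- by rewrite mulrC.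
- by rewrite posrE.
- by rewrite posrE divr_gt0 ?addr_gt0 ?ltr0n.
Qed.

End scaled_min_share.

Lemma measurable_scaled_min_share d (T : measurableType d) (R : realType) n
    (X Y : nat -> T -> R) :
  (forall i, measurable_fun setT (X i)) ->
  (forall i, measurable_fun setT (Y i)) ->
  measurable_fun setT (fun w => scaled_min_share n (X^~ w) (Y^~ w)).
Proof.
move=> mX mY; apply: measurable_divr; first exact: measurable_cst.
by apply: measurable_funD; [exact: measurable_max_ratio|exact: measurable_cst].
Qed.

Lemma measurable_qcc d (T : measurableType d) (R : realType) n
    (X Y : nat -> T -> R) :
  (forall i, measurable_fun setT (X i)) ->
  (forall i, measurable_fun setT (Y i)) ->
  measurable_fun setT (fun w => qcc n (X^~ w) (Y^~ w)).
Proof.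
move=> mX mY; have mYX := measurable_max_ratio n mX mY.
have mXY := measurable_max_ratio n mY mX.
by apply: measurable_divr; apply: measurable_funB; try exact: measurable_cst;
  [exact: measurable_funD|exact: measurable_funM].
Qed.

(* When [min_share_sum n x y = n] the two maxima are inverse to each other, and
   the division by zero in [qcc] yields [0]: hence the strict inequality. *)
Lemma qccE (R : realType) n (x y : nat -> R) : (0 < n)%N ->
  (forall i, 0 < x i) -> (forall i, 0 < y i) -> min_share_sum n x y < n%:R ->
  n%:R * qcc n x y = min_share_sum n x y +
    (scaled_min_share n x y - scaled_min_share n y x) ^+ 2
    / (n%:R - min_share_sum n x y).
Proof.
move=> n0 x0 y0; rewrite -subr_gt0.
have := max_ratio_gt0 y0 x0 n0; have := max_ratio_gt0 x0 y0 n0.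
rewrite /qcc /min_share_sum /scaled_min_share.
set M1 := max_upto n _; set M2 := max_upto n _ => M1_gt0 M2_gt0.
have nR : 0 < n%:R :> R by rewrite ltr0n.
have M1S : 0 < M1 + 1 by rewrite addr_gt0.
have M2S : 0 < M2 + 1 by rewrite addr_gt0.
have -> : n%:R - (n%:R / (M1 + 1) + n%:R / (M2 + 1)) =
    n%:R * (M1 * M2 - 1) / ((M1 + 1) * (M2 + 1)) by field; rewrite !gt_eqF.
rewrite pmulr_lgt0; last by rewrite invr_gt0 mulr_gt0.
rewrite pmulr_rgt0// => M_gt1.
by field; rewrite !gt_eqF.
Qed.

Lemma near_qcc_min_share_sum (R : realType) (c e : R) : 0 < e ->
  \forall n \near \oo, forall x y : nat -> R,
    (forall i, 0 < x i) -> (forall i, 0 < y i) -> min_share_sum n x y <= c ->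
    `|n%:R * qcc n x y - min_share_sum n x y| <= e.
Proof.
move=> e0; near=> n => x y x0 y0.
have n0 : (0 < n)%N by near: n; exact: nbhs_infty_gt.
have a0 := scaled_min_share_ge0 n x0 y0.
have b0 := scaled_min_share_ge0 n y0 x0.
have qE := qccE n0 x0 y0; move: a0 b0 qE; rewrite /min_share_sum.
set a := scaled_min_share n x y; set b := scaled_min_share n y x.
move=> a0 b0 qE abc.
have cn : c < n%:R by near: n; exact: nbhs_infty_gtr.
have large_n : c ^+ 2 <= e * (n%:R - c).
  rewrite -ler_pdivrMl// -lerBlDr opprK; near: n; exact: nbhs_infty_ger.
rewrite qE; last by lra.
rewrite addrAC subrr add0r ger0_norm; last by rewrite divr_ge0 ?sqr_ge0//; lra.
rewrite ler_pdivrMr; last by lra.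
apply: le_trans (_ : c ^+ 2 <= _).
  rewrite -[leLHS]real_normK ?num_real// lerXn2r ?nnegrE ?ler_norml//; lra.
by apply: (le_trans large_n); rewrite ler_wpM2l ?(ltW e0)//; lra.
Unshelve. all: end_near. Qed.

Section frechet_sample.
Context d (T : measurableType d) (R : realType) (P : probability T R).
Local Notation pr A := (fine (P A)).
Context (X Y : nat -> T -> R) (mX : forall i, measurable_fun setT (X i))
  (mY : forall i, measurable_fun setT (Y i)).
Hypothesis indepXY : mutually_independent_rv P
  (fun k : nat * bool => if k.2 then Y k.1 else X k.1).
Hypothesis cdfX : forall i x, P [set w | X i w <= x] = (frechet_cdf x)%:E.
Hypothesis cdfY : forall i x, P [set w | Y i w <= x] = (frechet_cdf x)%:E.
Local Notation A := (fun n w => scaled_min_share n (X^~ w) (Y^~ w)).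
Local Notation B := (fun n w => scaled_min_share n (Y^~ w) (X^~ w)).
Local Notation S := (fun n w => min_share_sum n (X^~ w) (Y^~ w)).

Let measurable_A n : measurable_fun setT (A n).
Proof. exact: measurable_scaled_min_share. Qed.

Let measurable_B n : measurable_fun setT (B n).
Proof. exact: measurable_scaled_min_share. Qed.

Let measurable_S n : measurable_fun setT (S n).
Proof. exact: measurable_funD. Qed.

Let measurable_nqcc n :
  measurable_fun setT (fun w => n%:R * qcc n (X^~ w) (Y^~ w)).
Proof.
by apply: measurable_funM; [exact: measurable_cst|exact: measurable_qcc].
Qed.

Lemma ae_sample_gt0 :
  {ae P, forall w, (forall i, 0 < X i w) /\ (forall i, 0 < Y i w)}.
Proof.
have X_gt0 := ae_foralln (fun i => ae_frechet_gt0 (mX i) (cdfX i)).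
have Y_gt0 := ae_foralln (fun i => ae_frechet_gt0 (mY i) (cdfY i)).
exact: filterS2 X_gt0 Y_gt0.
Qed.

Lemma sample_exponential_pair i :
  exponential_pair P (fun w => (X i w)^-1) (fun w => (Y i w)^-1).
Proof.
move=> a b a0 b0.
have minv c : measurable [set v : R | c <= v^-1].
  exact: (measurable_superlevel c (measurable_invr (@measurable_id _ R setT))).
have := pr_rectangle mX mY indepXY i (minv a) (minv b).
rewrite opprD expRD -(pr_frechet_inv_ge (mX i) (cdfX i) a0).
by rewrite -(pr_frechet_inv_ge (mY i) (cdfY i) b0).
Qed.

Lemma joint_surv_scaled_min_shares n a b : 0 <= a -> 0 <= b -> a + b < n%:R ->
  joint_surv P (A n) (B n) a b = (1 - (a + b) / n%:R) ^+ n.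
Proof.
move=> a0 b0 abn.
have nR : 0 < n%:R :> R by apply: le_lt_trans abn; rewrite addr_ge0.
have n0 : (0 < n)%N by rewrite -(ltr0n R).
pose E (i : nat) := [set w | a / n%:R <= share (X i w) (Y i w) /\
                             b / n%:R <= share (Y i w) (X i w)].
have mE i : measurable (E i).
  by apply: measurable_orthant; exact: measurable_share.
transitivity (pr (\big[setI/setT]_(i < n) E i)).
  apply: ae_eq_pr.
  - exact: measurable_orthant.
  - exact: bigsetI_measurable.
  - apply: filterS ae_sample_gt0 => w [X0 Y0]; rewrite -bigcap_mkord /=.
    rewrite !le_scaled_min_share//; split => [[aX bY] i ni|ab].
      by split; [exact: aX|exact: bY].
    by split => i ni; have [] := ab i ni.
have sE (i : 'I_n) : <<s rectangles (X i) (Y i) >> (E i).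
  have [mX' mY'] := rectangles_measurable_fun (X i) (Y i).
  have mXY' := measurable_share mX' mY'; have mYX' := measurable_share mY' mX'.
  exact: (measurable_orthant mXY' mYX').
rewrite (independent_pairs mX mY indepXY sE).
rewrite -[n in _ ^+ n]card_ord -prodr_const.
apply: eq_bigr => i _; rewrite (pr_shares_ge (mX i) (mY i)) ?mulrDl//.
- by apply: filterS ae_sample_gt0 => w [].
- exact: sample_exponential_pair.
- by rewrite divr_ge0.
- by rewrite divr_ge0.
- by rewrite -mulrDl ltr_pdivrMr// mul1r.
Qed.

Lemma cvg_joint_surv_scaled_min_shares a b : 0 <= a -> 0 <= b ->
  joint_surv P (A n) (B n) a b @[n --> \oo] --> expR (- (a + b)).
Proof.
move=> a0 b0; apply: cvg_trans (@cvg_expn_expR R (a + b)); apply: near_eq_cvg.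
near=> n; rewrite joint_surv_scaled_min_shares//.
by near: n; exact: nbhs_infty_gtr.
Unshelve. all: end_near. Qed.

Let measurable_max_ratio_event n x (U V : nat -> T -> R) :
  (forall i, measurable_fun setT (U i)) ->
  (forall i, measurable_fun setT (V i)) ->
  measurable [set w | n%:R^-1 * (max_upto n (fun i => V i w / U i w) + 1) <= x].
Proof.
move=> mU mV; apply: measurable_sublevel.
apply: measurable_funM; first exact: measurable_cst.
by apply: measurable_funD; [exact: measurable_max_ratio|exact: measurable_cst].
Qed.

Lemma cvg_max_ratio (x : R) : 0 < x ->
  P [set w | n%:R^-1 * (max_upto n (fun i => Y i w / X i w) + 1) <= x]
    @[n --> \oo] --> (expR (- x^-1))%:E.
Proof.
move=> x0; apply/cvg_prP => [n|]; first exact: measurable_max_ratio_event.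
have joint_cvg :
    joint_surv P (A n) (B n) x^-1 0 @[n --> \oo] --> expR (- (x^-1 + 0)).
  by apply: cvg_joint_surv_scaled_min_shares; rewrite // invr_ge0 ltW.
rewrite addr0 in joint_cvg; apply: cvg_trans joint_cvg.
apply: near_eq_cvg; near=> n.
have n0 : (0 < n)%N by near: n; exact: nbhs_infty_gt.
apply: ae_eq_pr.
- exact: measurable_orthant.
- exact: measurable_max_ratio_event.
- apply: filterS ae_sample_gt0 => w [X0 Y0] /=.
  rewrite max_ratio_le_scaled_min_share//.
  by split => [[]//|xA]; split => //; exact: scaled_min_share_ge0.
Unshelve. all: end_near. Qed.

Lemma cvg_max_ratios (x y : R) : 0 < x -> 0 < y ->
  P [set w | n%:R^-1 * (max_upto n (fun i => Y i w / X i w) + 1) <= x /\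
             n%:R^-1 * (max_upto n (fun i => X i w / Y i w) + 1) <= y]
    @[n --> \oo] --> (expR (- x^-1 - y^-1))%:E.
Proof.
move=> x0 y0; have mE n : measurable
    [set w | n%:R^-1 * (max_upto n (fun i => Y i w / X i w) + 1) <= x /\
             n%:R^-1 * (max_upto n (fun i => X i w / Y i w) + 1) <= y].
  by apply: measurableI; exact: measurable_max_ratio_event.
apply/(cvg_prP P _ mE); rewrite -opprD.
have joint_cvg : joint_surv P (A n) (B n) x^-1 y^-1 @[n --> \oo] -->
    expR (- (x^-1 + y^-1)).
  by apply: cvg_joint_surv_scaled_min_shares; rewrite // invr_ge0 ltW.
apply: cvg_trans joint_cvg; apply: near_eq_cvg; near=> n.
have n0 : (0 < n)%N by near: n; exact: nbhs_infty_gt.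
apply: ae_eq_pr => //; first exact: measurable_orthant.
apply: filterS ae_sample_gt0 => w [X0 Y0].
by rewrite /= !max_ratio_le_scaled_min_share.
Unshelve. all: end_near. Qed.

Lemma cvg_pr_min_share_sum_ge (t : R) :
  pr [set w | t <= S n w] @[n --> \oo] --> gamma21_surv (Num.max 0 t).
Proof.
have [t_lt0|t_ge0] := ltP t 0.
  apply: cvg_near_cst; apply: nearW => n.
  rewrite gamma21_surv0 -(pr_setT P).
  apply: ae_eq_pr => //; first exact: measurable_superlevel.
  apply: filterS ae_sample_gt0 => w [X0 Y0]; split=> // _.
  apply: (le_trans (ltW t_lt0)).
  by rewrite addr_ge0 ?scaled_min_share_ge0.
have -> : gamma21_surv t = expR (- t) - t * (- expR (- t)).
  by rewrite /gamma21_surv; ring.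
apply: (cvg_pr_sum_ge (g := fun s => expR (- s)) t_ge0) => //.
- exact: cvg_joint_surv_scaled_min_shares.
- by rewrite oppr0 expR0.
- by apply: is_derive_eq; rewrite /GRing.scale /=; ring.
Qed.

Lemma cvg_in_distribution_min_share_sum :
  cvg_in_distribution P S (@gamma21_cdf R).
Proof.
apply: cvg_in_distribution_lt => //; first exact: continuous_gamma21_cdf.
move=> t; rewrite gamma21_cdfE.
under eq_fun => n.
  rewrite (_ : [set w | S n w < t] = ~` [set w | t <= S n w]); last first.
    by apply/seteqP; split => w /=; rewrite ltNge => /negP.
  rewrite prC; last exact: measurable_superlevel.
over.
by apply: cvgB; [exact: cvg_cst|exact: cvg_pr_min_share_sum_ge].
Qed.

Lemma cvg_in_distribution_qcc : cvg_in_distribution P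
  (fun n w => n%:R * qcc n (X^~ w) (Y^~ w)) (@gamma21_cdf R).
Proof.
have cF := @continuous_gamma21_cdf R.
have cvgS := cvg_in_distribution_min_share_sum.
apply: (cvg_in_distribution_slutsky cF measurable_S) => //.
apply: (tight_above_cvg_in_probability0 measurable_S).
- by move=> n; exact: measurable_funB.
- exact: cvg_in_distribution_tight_above (@cvgy_gamma21_cdf R).
- move=> c e e0; apply: filterS (near_qcc_min_share_sum c e0) => n near_sum.
  by apply: filterS ae_sample_gt0 => w [X0 Y0]; exact: near_sum.
Qed.

End frechet_sample.

Theorem theorem3p1 (d : measure_display) (T : measurableType d) (R : realType)
  (P : probability T R) (X Y : nat -> T -> R)
  (mX : forall i, measurable_fun setT (X i))
  (mY : forall i, measurable_fun setT (Y i))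
  (indep : mutually_independent_rv P
             (fun k : nat * bool => if k.2 then Y k.1 else X k.1))
  (cdfX : forall i (x : R), P [set w | X i w <= x] = (frechet_cdf x)%:E)
  (cdfY : forall i (x : R), P [set w | Y i w <= x] = (frechet_cdf x)%:E) :
  (forall x : R, 0 < x ->
     (P [set w | n%:R^-1 * (max_upto n (fun i => Y i w / X i w) + 1) <= x])
       @[n --> \oo] --> (expR (- x^-1))%:E)
  /\
  (forall x y : R, 0 < x -> 0 < y ->
     (P [set w | n%:R^-1 * (max_upto n (fun i => Y i w / X i w) + 1) <= x /\
                 n%:R^-1 * (max_upto n (fun i => X i w / Y i w) + 1) <= y])
       @[n --> \oo] --> (expR (- x^-1 - y^-1))%:E)
  /\
  cvg_in_distribution P
    (fun n w => n%:R * qcc n (fun i => X i w) (fun i => Y i w)) (@gamma21_cdf R).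
Proof.
split; first by move=> x; exact: cvg_max_ratio.
split; first by move=> x y; exact: cvg_max_ratios.
exact: cvg_in_distribution_qcc.
Qed.
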